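(* Let $h=0$, $\rho>0$ and $\varepsilon,\varepsilon'\in(-\frac{\rho J}2,0]$. If $\varepsilon\ne0$, \[ w_2(\mu_{\mathrm{MC}}^{\varepsilon,\rho;N},\mu_{\mathrm{MC}}^{\varepsilon',\rho;N};N)\le\frac2J\frac{1}{\sqrt{-\frac{2\varepsilon}J}\sqrt{1-\left(-\frac{2\varepsilon}{J\rho}\right)}}|\varepsilon-\varepsilon'|, \] and for $\varepsilon=0$, \[ w_2(\mu_{\mathrm{MC}}^{0,\rho;N},\mu_{\mathrm{MC}}^{\varepsilon',\rho;N};N)\le\frac2{\sqrt J}|\varepsilon'|^{1/2}. \]
   Context: Mean-field spherical model with $h=0$: $\phi\in\mathbb{R}^N$ ($N$ lattice sites), $J>0$, $H[\phi]=-\frac J{2N}(\sum_x\phi_x)^2$. For $\rho>0$, $|m|<\sqrt\rho$, $\mu_{\mathrm{MC}}^{m,\rho;N}$ is the normalized uniform surface measure on $\{\sum_x\phi_x=mN,\ \sum_x\phi_x^2=\rho N\}$. For $\varepsilon\in(-\frac{\rho J}2,0)$ the microcanonical ensemble is $\mu_{\mathrm{MC}}^{\varepsilon,\rho;N}=\frac12\mu_{\mathrm{MC}}^{m_+,\rho;N}+\frac12\mu_{\mathrm{MC}}^{m_-,\rho;N}$ with $m_\pm=\pm\sqrt{-2\varepsilon/J}$, and $\mu_{\mathrm{MC}}^{0,\rho;N}=\mu_{\mathrm{MC}}^{m,\rho;N}|_{m=0}$. $w_2(\mu_1,\mu_2;N)=\left(\inf_\gamma\int\gamma(dx,dy)\frac1N\sum_i|x_i-y_i|^2\right)^{1/2}$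 over couplings of $\mu_1,\mu_2$. *)

(* Defs.v *)
From HB Require Import structures.
From mathcomp Require Import all_boot all_order all_algebra.
From mathcomp Require Import all_classical all_reals all_analysis.
Set Implicit Arguments. Unset Strict Implicit. Unset Printing Implicit Defensive.
Import Order.TTheory GRing.Theory Num.Theory.
Import numFieldNormedType.Exports.
Local Open Scope classical_set_scope.
Local Open Scope ring_scope.

Section MeanFieldSpherical.
Context {R : realType} {N : nat}.

(* configurations phi in R^N, as N-tuples (product Borel sigma-algebra) *)
Notation V := (N.-tuple R).

Definition edist (x y : V) : R :=
  Num.sqrt (\sum_(i < N) (tnth x i - tnth y i) ^+ 2).

(* diameter of a set (in \bar R); -oo for the empty set *)
Definition ediam (U : set V) : \bar R :=
  ereal_sup [set (edist x y)%:E | x in U & y in U].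

(* s-dimensional Hausdorff content of a covering set, with diam(empty)^s = 0
   (covering sets always have finite diameter <= delta below) *)
Definition hcontent (s : nat) (U : set V) : \bar R :=
  if `[< U = set0 >] then 0%E else ((fine (ediam U)) ^+ s)%:E.

Definition hausdorff_delta (s : nat) (delta : R) (A : set V) : \bar R :=
  ereal_inf [set (\sum_(i <oo) hcontent s (F i))%E |
    F in [set F : nat -> set V |
      A `<=` \bigcup_i F i /\ forall i, (ediam (F i) <= delta%:E)%E]].

(* (unnormalized) s-dimensional Hausdorff (outer) measure on R^N *)
Definition hausdorff (s : nat) (A : set V) : \bar R :=
  ereal_sup [set hausdorff_delta s delta A | delta in [set d : R | 0 < d]].

Definition MCsurface (m rho : R) : set V :=
  [set phi | \sum_(i < N) tnth phi i = m * N%:R /\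
             \sum_(i < N) tnth phi i ^+ 2 = rho * N%:R].

(* mu_MC^{m,rho;N}: normalized uniform surface measure on MCsurface m rho,
   i.e. the (N-2)-dimensional Hausdorff measure restricted to the surface,
   divided by its total mass *)
Definition muMC_m (m rho : R) (A : set V) : \bar R :=
  (hausdorff (N - 2) (A `&` MCsurface m rho) *
   ((fine (hausdorff (N - 2) (MCsurface m rho)))^-1)%:E)%E.

Definition muMC_eps (J eps rho : R) (A : set V) : \bar R :=
  if eps == 0 then muMC_m 0 rho A
  else ((2^-1)%:E * muMC_m (Num.sqrt (- (2 * eps) / J)) rho A +
        (2^-1)%:E * muMC_m (- Num.sqrt (- (2 * eps) / J)) rho A)%E.

Definition coupling (mu1 mu2 : set V -> \bar R)
  (gamma : probability (V * V)%type R) : Prop :=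
  (forall A : set V, measurable A -> gamma (A `*` setT) = mu1 A) /\
  (forall A : set V, measurable A -> gamma (setT `*` A) = mu2 A).

Definition esqrt (x : \bar R) : \bar R :=
  match x with
  | EFin r => (Num.sqrt r)%:E
  | +oo%E => +oo%E
  | -oo%E => 0%E
  end.

Definition w2 (mu1 mu2 : set V -> \bar R) : \bar R :=
  esqrt (ereal_inf [set (\int[gamma]_z
            ((N%:R)^-1 * \sum_(i < N) (tnth z.1 i - tnth z.2 i) ^+ 2)%:E)%E
          | gamma in [set g | coupling mu1 mu2 g]]).

End MeanFieldSpherical.

(* Main.v *)
Require Import Defs.
From HB Require Import structures.
From mathcomp Require Import all_boot all_order all_algebra.
From mathcomp Require Import all_classical all_reals all_analysis.
From mathcomp Require Import measurable_realfun.
From mathcomp Require Import ring lra.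
(* Shadows the extended distance [edist] of mathcomp-analysis. *)
Import Defs.
Import Order.TTheory GRing.Theory Num.Theory.
Set Implicit Arguments. Unset Strict Implicit. Unset Printing Implicit Defensive.
Local Open Scope classical_set_scope.
Local Open Scope ring_scope.

(* With r = sqrt (rho - m^2), the map x |-> m + r x is a similarity from the surface
   S = {sum x = 0, sum x^2 = N} onto {sum x = m N, sum x^2 = rho N}, so it transports
   the uniform probability on S to mu_MC^{m,rho;N}. Coupling the images of one and the
   same point of S, with the same sign for both magnetizations, gives the constant cost
   (m - m')^2 + (r - r')^2; both bounds then follow from elementary inequalities for
   chords of the circle m^2 + r^2 = rho.

   For this to be a coupling of probabilities, the (N - 2)-dimensional Hausdorff measure
   has to be countably additive on the product sigma-algebra and 0 < H(S) < oo.
   Additivity is Caratheodory's criterion for coordinate half-spaces. Finiteness comes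
   from covering S by charts in which two coordinates are Lipschitz functions of the
   N - 2 others. For positivity, S projects onto a set containing a cube of dimension
   N - 2, and boxes covering a cube have total volume at least that of the cube. *)

(** * The Hausdorff outer measure *)

Section edist_theory.
Context {R : realType} {N : nat}.
Implicit Types (x y : N.-tuple R) (U A B : set (N.-tuple R)).

Lemma edistxx x : edist x x = 0.
Proof. by rewrite /edist big1 ?sqrtr0// => i _; rewrite subrr expr0n. Qed.

Lemma edist_coord x y i : `|tnth x i - tnth y i| <= edist x y.
Proof.
rewrite -sqrtr_sqr ler_wsqrtr// (bigD1 i)//= lerDl sumr_ge0// => j _.
exact: sqr_ge0.
Qed.

(** The sharp factor would be the square root of [N]. The cruder [N] suffices, as it only enters a
    constant in a finiteness bound. *)
Lemma edist_sup x y (e : R) : 0 <= e ->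
  (forall i, `|tnth x i - tnth y i| <= e) -> edist x y <= N%:R * e.
Proof.
move=> e0 xye; have Ne0 : 0 <= N%:R * e by rewrite mulr_ge0.
rewrite -(ger0_norm Ne0) -sqrtr_sqr ler_wsqrtr//.
apply: (@le_trans _ _ (\sum_(i < N) e ^+ 2)).
  by apply: ler_sum => i _; rewrite -real_normK ?num_real// lerXn2r ?nnegrE.
rewrite sumr_const card_ord exprMn -[leLHS]mulr_natl ler_wpM2r ?sqr_ge0//.
by rewrite -natrX ler_nat; case: (N) => // n; rewrite leq_pmulr.
Qed.

Lemma ediam_ub U x y : U x -> U y -> ((edist x y)%:E <= ediam U)%E.
Proof. by move=> Ux Uy; apply: ereal_sup_ubound; exists x => //; exists y. Qed.

Lemma ge_ediam U (M : \bar R) :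
  (forall x y, U x -> U y -> (edist x y)%:E <= M)%E -> (ediam U <= M)%E.
Proof. by move=> UM; apply: ge_ereal_sup => _ [x Ux [y Uy] <-]; exact: UM. Qed.

Lemma ediam_set0 : ediam (set0 : set (N.-tuple R)) = -oo%E.
Proof.
by apply/eqP; rewrite -leeNy_eq; apply: ge_ediam.
Qed.

Lemma fine_ediam_ge0 U : U !=set0 -> 0 <= fine (ediam U).
Proof.
by move=> [x Ux]; rewrite fine_ge0// (le_trans _ (ediam_ub Ux Ux))// edistxx.
Qed.

Lemma ediam_fin U (d : R) : U !=set0 -> (ediam U <= d%:E)%E ->
  ediam U = (fine (ediam U))%:E.
Proof.
move=> [x Ux] Ud; rewrite fineK// fin_numE -ltey (le_lt_trans Ud (ltry _)) andbT.
by rewrite -ltNye (lt_le_trans _ (ediam_ub Ux Ux))// ltNyr.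
Qed.

Lemma hcontent_set0 s : hcontent s (set0 : set (N.-tuple R)) = 0%E.
Proof. by rewrite /hcontent asboolT. Qed.

Lemma hcontentE s U : U !=set0 -> hcontent s U = ((fine (ediam U)) ^+ s)%:E.
Proof. by move=> /set0P/eqP U0; rewrite /hcontent asboolF. Qed.

Lemma hcontent_ge0 s U : (0 <= hcontent s U)%E.
Proof.
have [->|/set0P U0] := eqVneq U set0; first by rewrite hcontent_set0.
by rewrite hcontentE// lee_fin exprn_ge0// fine_ediam_ge0.
Qed.

Lemma le_hcontent s U (d : R) : 0 <= d -> (ediam U <= d%:E)%E ->
  (hcontent s U <= (d ^+ s)%:E)%E.
Proof.
move=> d0 Ud; have [->|/set0P U0] := eqVneq U set0.
  by rewrite hcontent_set0 lee_fin exprn_ge0.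
rewrite hcontentE// lee_fin lerXn2r ?nnegrE ?fine_ediam_ge0//.
by rewrite -lee_fin -(ediam_fin U0 Ud).
Qed.

End edist_theory.

(* Generated sigma-algebras and the Caratheodory sigma-algebra are only available
   on pointed types; this packing equips tuples with a point without touching
   the canonical structures on [N.-tuple R]. *)
Definition pointed_tuple (R : realType) (N : nat) : pointedType :=
  HB.pack_for pointedType (N.-tuple R)
    (isPointed.Build (N.-tuple R) [tuple 0 | _ < N]).

Section hausdorff_outer_measure.
Context {R : realType} {N : nat}.
Local Notation V := (N.-tuple R).
Local Open Scope ereal_scope.
Implicit Types (s : nat) (d : R) (A B : set V).

(** The value [+oo] on sets of diameter above [d] encodes the mesh constraint in the set function
    itself, so that arbitrary covers may be used. *)
Definition capped_content s d (U : set V) : \bar R :=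
  if ediam U <= d%:E then hcontent s U else +oo.

Lemma capped_content0 s d : capped_content s d set0 = 0.
Proof. by rewrite /capped_content ediam_set0 leNye hcontent_set0. Qed.

Lemma capped_content_ge0 s d U : 0 <= capped_content s d U.
Proof. by rewrite /capped_content; case: ifPn => // _; exact: hcontent_ge0. Qed.

(* Every subset is measurable in the sigma-algebra generated by [setT], so
   [mu_ext] ranges over arbitrary covers here. *)
Lemma hausdorff_deltaE s d : hausdorff_delta s d =
  @mu_ext _ (g_sigma_algebraType [set: set (pointed_tuple R N)]) R (capped_content s d).
Proof.
apply/funext => A; apply/eqP; rewrite eq_le; apply/andP; split.
  apply: le_ereal_inf_tmp => _ [F [_ AF] <-].
  (* A cover with an oversized set has infinite total capped content, and there is nothing to prove
     for it. *)
  have [Fd|] := pselect (forall i, ediam (F i) <= d%:E).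
    apply: ereal_inf_lbound; exists F => //.
    by apply: eq_eseriesr => i _; rewrite /capped_content Fd.
  move=> /existsNP[i Fid].
  rewrite (@eseries_pinfty _ _ _ i) ?leey//.
    by move=> n _; rewrite -ltNye (lt_le_trans _ (capped_content_ge0 _ _ _)).
  by rewrite /capped_content; case: ifPn.
apply: le_ereal_inf_tmp => _ [F [AF Fd] <-]; apply: ereal_inf_lbound.
exists F; first by split => // i; exact: sub_sigma_algebra.
by apply: eq_eseriesr => i _; rewrite /capped_content Fd.
Qed.

Lemma hausdorff_delta0 s d : hausdorff_delta s d (set0 : set V) = 0.
Proof.
rewrite hausdorff_deltaE.
exact: (@mu_ext0 _ (g_sigma_algebraType [set: set (pointed_tuple R N)]) R _
  (capped_content0 s d) (capped_content_ge0 s d)).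
Qed.

Lemma hausdorff_delta_ge0 s d A : 0 <= hausdorff_delta s d A.
Proof.
by rewrite hausdorff_deltaE; apply: mu_ext_ge0; exact: capped_content_ge0.
Qed.

Lemma le_hausdorff_delta s d : {homo @hausdorff_delta R N s d : A B / A `<=` B >-> A <= B}.
Proof.
rewrite hausdorff_deltaE => A B.
exact: (@le_mu_ext _ (g_sigma_algebraType [set: set (pointed_tuple R N)])).
Qed.

Lemma hausdorff_delta_sigma_subadditive s d :
  sigma_subadditive (@hausdorff_delta R N s d).
Proof.
rewrite hausdorff_deltaE; apply: (@mu_ext_sigma_subadditive _
  (g_sigma_algebraType [set: set (pointed_tuple R N)])).
exact: capped_content_ge0.
Qed.

HB.instance Definition _ s d := isOuterMeasure.Build R V (@hausdorff_delta R N s d)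
  (hausdorff_delta0 s d) (hausdorff_delta_ge0 s d) (@le_hausdorff_delta s d)
  (@hausdorff_delta_sigma_subadditive s d).

Lemma hausdorff_delta_anti s d d' A : (d <= d')%R ->
  hausdorff_delta s d' A <= hausdorff_delta s d A.
Proof.
move=> dd'; apply: le_ereal_inf_tmp => _ [F [AF Fd] <-].
apply: ereal_inf_lbound; exists F => //; split => // i.
by rewrite (le_trans (Fd i))// lee_fin.
Qed.

Lemma hausdorff_delta_le_hcontent s d A : ediam A <= d%:E ->
  hausdorff_delta s d A <= hcontent s A.
Proof.
move=> Ad; apply: ereal_inf_lbound; exists (fun i => if i is 0%N then A else set0).
  split; first by move=> x Ax; exists 0%N.
  by case=> [//|i]; rewrite ediam_set0 leNye.
rewrite nneseries_recl//; last by move=> k _; exact: hcontent_ge0.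
rewrite eseries_cond/= eseries0 ?adde0// => -[|]//= k _ _.
by rewrite hcontent_set0.
Qed.

Lemma le_hausdorff_sup s d A : (0 < d)%R ->
  hausdorff_delta s d A <= hausdorff s A.
Proof. by move=> d0; apply: ereal_sup_ubound; exists d. Qed.

Lemma ge_hausdorff s A (M : \bar R) :
  (forall d, (0 < d)%R -> hausdorff_delta s d A <= M) -> hausdorff s A <= M.
Proof. by move=> AM; apply: ge_ereal_sup => _ [d /= d0 <-]; exact: AM. Qed.

Lemma hausdorff_ge0 s A : 0 <= hausdorff s A.
Proof. by rewrite (le_trans _ (@le_hausdorff_sup s 1%R A ltr01))// hausdorff_delta_ge0. Qed.

Lemma hausdorff0 s : hausdorff s (set0 : set V) = 0.
Proof.
apply/eqP; rewrite eq_le hausdorff_ge0 andbT.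
by apply: ge_hausdorff => d _; rewrite hausdorff_delta0.
Qed.

Lemma le_hausdorff s : {homo @hausdorff R N s : A B / A `<=` B >-> A <= B}.
Proof.
move=> A B AB; apply: ge_hausdorff => d d0.
apply: le_trans (le_hausdorff_sup s B d0).
exact: le_hausdorff_delta.
Qed.

Lemma hausdorff_sigma_subadditive s :
  sigma_subadditive (@hausdorff R N s).
Proof.
move=> F; apply: ge_hausdorff => d d0.
apply: (le_trans (hausdorff_delta_sigma_subadditive _ _ _)).
apply: lee_nneseries => [*|i _]; first exact: hausdorff_delta_ge0.
exact: le_hausdorff_sup.
Qed.

HB.instance Definition _ s := isOuterMeasure.Build R V (@hausdorff R N s)
  (hausdorff0 s) (hausdorff_ge0 s) (@le_hausdorff s)
  (@hausdorff_sigma_subadditive s).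

(** A set of diameter at most [d < c] cannot meet both [A] and [B]. Hence a cover of the union
    splits into a cover of [A] and one of [B] that share no nonempty set. *)
Lemma hausdorff_deltaU_ge s d A B (c : R) : (d < c)%R ->
  (forall x y, A x -> B y -> (c <= edist x y)%R) ->
  hausdorff_delta s d A + hausdorff_delta s d B <= hausdorff_delta s d (A `|` B).
Proof.
move=> dc ABc; apply: le_ereal_inf_tmp => _ [F [ABF Fd] <-].
pose G C i := if `[< F i `&` C !=set0 >] then F i else set0.
have HG C : C `<=` A `|` B ->
    hausdorff_delta s d C <= \sum_(i <oo) hcontent s (G C i).
  move=> CAB; apply: ereal_inf_lbound; exists (G C) => //; split.
    move=> x Cx; have [i _ Fix] := ABF _ (CAB _ Cx).
    by exists i => //; rewrite /G asboolT//; exists x.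
  by move=> i; rewrite /G; case: ifPn => // _; rewrite ediam_set0 leNye.
apply: (le_trans (leeD (HG A _) (HG B _))); [exact: subsetUl|exact: subsetUr|].
rewrite -nneseriesD; [|by move=> *; exact: hcontent_ge0..].
apply: lee_nneseries => [*|i _]; first by rewrite adde_ge0// hcontent_ge0.
rewrite /G; case: (asboolP (F i `&` A !=set0)) => [[x [Fx Ax]]|_].
  case: asboolP => [[y [Fy By]]|_]; last by rewrite hcontent_set0 adde0.
  have : ediam (F i) < c%:E by rewrite (le_lt_trans (Fd i))// lte_fin.
  rewrite ltNge => /negP; case.
  by rewrite (le_trans _ (ediam_ub Fx Fy))// lee_fin ABc.
rewrite hcontent_set0 add0e; case: asboolP => // _.
by rewrite hcontent_set0 hcontent_ge0.
Qed.

(** Premeasures grow as the mesh shrinks, so two meshes can be replaced by a common one below [c].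
    The suprema over [d2] and [d1] are then taken one after the other, subtraction being legitimate
    once the union has finite measure. *)
Lemma hausdorffU_sep s A B (c : R) : (0 < c)%R ->
  (forall x y, A x -> B y -> (c <= edist x y)%R) ->
  hausdorff s A + hausdorff s B <= hausdorff s (A `|` B).
Proof.
move=> c0 ABc.
have H d1 d2 : (0 < d1)%R -> (0 < d2)%R ->
    hausdorff_delta s d1 A + hausdorff_delta s d2 B <= hausdorff s (A `|` B).
  move=> d10 d20; pose d := Num.min (Num.min d1 d2) (c / 2)%R.
  have d0 : (0 < d)%R by rewrite !lt_min d10 d20 divr_gt0.
  apply: (le_trans _ (le_hausdorff_sup _ _ d0)).
  apply: (le_trans _ (@hausdorff_deltaU_ge s d A B c _ ABc)).
    by apply: leeD; apply: hausdorff_delta_anti; rewrite !ge_min lexx ?orbT.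
  by rewrite (@le_lt_trans _ _ (c / 2)%R)// ?ge_min ?lexx ?orbT//; lra.
have := hausdorff_ge0 s (A `|` B).
case HE : (hausdorff s (A `|` B)) => [M| |] // _; last by rewrite leey.
rewrite HE in H.
have finA d1 : (0 < d1)%R -> hausdorff_delta s d1 A \is a fin_num.
  move=> d10; rewrite ge0_fin_numE ?hausdorff_delta_ge0//.
  rewrite (@le_lt_trans _ _ M%:E) ?ltry//.
  by apply: le_trans (H _ _ d10 d10); rewrite leeDl// hausdorff_delta_ge0.
have H2 d1 : (0 < d1)%R -> hausdorff_delta s d1 A + hausdorff s B <= M%:E.
  move=> d10; rewrite addeC -leeBrDr ?finA//; apply: ge_hausdorff => d2 d20.
  by rewrite leeBrDr ?finA// addeC H.
have finB : hausdorff s B \is a fin_num.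
  rewrite ge0_fin_numE ?hausdorff_ge0//.
  rewrite (@le_lt_trans _ _ M%:E) ?ltry//.
  by apply: le_trans (H2 _ ltr01); rewrite leeDr// hausdorff_delta_ge0.
rewrite -leeBrDr//; apply: ge_hausdorff => d1 d10.
by rewrite leeBrDr// H2.
Qed.

End hausdorff_outer_measure.

(** * Caratheodory measurability *)

Section metric_outer_measure.
Context {R : realType} {T : Type} (nu : {outer_measure set T -> \bar R}).
Local Open Scope ereal_scope.

(* Caratheodory's criterion for the superlevel sets of [f]: slabs of even index are
   mutually separated, and so are those of odd index, so the slabs accumulating at
   level [a] have finite total mass. *)
Lemma superlevel_caratheodory (f : T -> R) :
  (forall (A B : set T) (a b : R), (a < b)%R ->
    (forall x, A x -> (f x <= a)%R) -> (forall x, B x -> (b <= f x)%R) ->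
    nu A + nu B <= nu (A `|` B)) ->
  forall a, nu.-caratheodory [set x | (a < f x)%R].
Proof.
move=> sep a; apply: le_caratheodory_measurable => X.
have := outer_measure_ge0 nu X; case nuX : (nu X) => [M| |]// _; last by rewrite leey.
pose r n : R := (a + n.+1%:R^-1)%R.
have ar n : (a < r n)%R by rewrite ltrDl invr_gt0.
have rS m n : (m < n)%N -> (r n < r m)%R.
  by move=> mn; rewrite ltrD2l ltf_pV2 ?posrE// ltr_nat ltnS.
(* The levels [r n] decrease to [a], and [E k] is the slab between two consecutive ones. *)
pose E k := X `&` [set x | (r k.+2 <= f x)%R /\ (f x < r k.+1)%R].
(* Here [p] is the parity. The next slab lies below level [r (n.*2 + p).+1] and the earlier ones
   above [r (n.*2 + p)]; the skipped slab is the gap. *)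
have half p n : \sum_(k < n) nu (E (k.*2 + p)%N) <=
    nu (X `&` [set x | (r (n.*2 + p)%N <= f x)%R]).
  elim: n => [|n IH]; first by rewrite big_ord0 outer_measure_ge0.
  rewrite big_ord_recr/= (le_trans (leeD2r _ IH))// addeC.
  apply: (le_trans (sep _ _ (r (n.*2 + p).+1) (r (n.*2 + p)%N) _ _ _)).
  - exact: rS.
  - by move=> x [_ [_ /ltW]].
  - by move=> x [].
  - apply: le_outer_measure => x [[Xx [h _]]|[Xx /= h]]; split => //=.
    by rewrite doubleS !addSn (le_trans _ h)// ltW// rS// ltnW.
have halfX p n : \sum_(k < n) nu (E (k.*2 + p)%N) <= M%:E.
  by rewrite (le_trans (half p n))// -nuX le_outer_measure.
have evenodd n : \sum_(k < n.*2) nu (E k) =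
    \sum_(k < n) nu (E (k.*2 + 0)%N) + \sum_(k < n) nu (E (k.*2 + 1)%N).
  elim: n => [|n IH]; first by rewrite !big_ord0 adde0.
  by rewrite doubleS !big_ord_recr/= IH addn0 addn1 -!addeA; congr (_ + _);
     rewrite addeCA.
have tail_fin : \sum_(k <oo) nu (E k) < +oo.
  rewrite (@le_lt_trans _ _ (M%:E + M%:E))// -?EFinD ?ltry//.
  apply: lime_le; first by apply: is_cvg_nneseries => *; exact: outer_measure_ge0.
  apply: nearW => n; apply: (@le_trans _ _ (\sum_(k < n.*2) nu (E k))).
    rewrite -(big_mkord xpredT (nu \o E)) /=.
    apply: lee_sum_nneg_natr => //; last by rewrite -addnn leq_addr.
    by move=> *; exact: outer_measure_ge0.
  by rewrite evenodd ?EFinD leeD// halfX.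
have /nneseries_tail_cvg tail0 := tail_fin.
have {}tail0 := tail0 (fun k _ => outer_measure_ge0 nu (E k)).
(* The part above [a] is [Y], which a positive gap separates from the part below, together with the
   slabs from index [n] on. Their total mass tends to 0. *)
have bound n : nu (X `&` [set x | (a < f x)%R]) +
    nu (X `&` ~` [set x | (a < f x)%R]) <= M%:E + \sum_(n <= k <oo) nu (E k).
  pose Y := X `&` [set x | (r n.+1 <= f x)%R].
  have cover : X `&` [set x | (a < f x)%R] `<=`
      Y `|` \bigcup_(k in ~` `I_n) E k.
    move=> x [Xx /= ax]; case: (leP (r n.+1) (f x)) => rx; [by left|right].
    have fxa : (0 < f x - a)%R by rewrite subr_gt0.
    have ex : exists k, (r k.+2 <= f x)%R.
      exists (Num.truncn (f x - a)^-1); rewrite -lerBrDl -[leRHS]invrK.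
      rewrite lef_pV2 ?posrE ?invr_gt0// ltW//.
      rewrite (lt_le_trans (truncnS_gt _))// ler_nat.
      by rewrite !ltnS leqW.
    (* The least [k] with [r k.+2 <= f x] is the index of the slab containing [x]. *)
    case: (ex_minnP ex) => k rk kmin.
    have nk : (n <= k)%N.
      rewrite leqNgt; apply/negP => kn; move: rx; apply/negP; rewrite -leNgt.
      apply: le_trans rk; move: kn; rewrite leq_eqVlt => /predU1P[<-//|kn].
      by rewrite ltW// rS.
    exists k; first by apply/negP; rewrite -leqNgt.
    split => //; split => //; rewrite ltNge; apply/negP => rk1.
    case: k rk kmin nk rk1 => [|k] rk kmin nk rk1.
      by move: nk rx; rewrite leqn0 => /eqP ->; rewrite ltNge rk1.
    by have := kmin _ rk1; rewrite ltnn.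
  have step : nu (X `&` [set x | (a < f x)%R]) <=
      nu Y + \sum_(n <= k <oo) nu (E k).
    apply: (le_trans (le_outer_measure nu _ _ cover)).
    apply: (le_trans (outer_measureU2 _ _ _)).
    by rewrite leeD2l// outer_measure_sigma_subadditive_tail.
  apply: (le_trans (leeD2r _ step)); rewrite addeAC leeD2r// addeC -nuX.
  apply: (le_trans (sep _ _ a (r n.+1) (ar _) _ _)).
  - by move=> x [_ /= /negP]; rewrite -leNgt.
  - by move=> x [].
  - by apply: le_outer_measure => x [[]|[]].
have : limn (fun n => M%:E + \sum_(n <= k <oo) nu (E k)) = M%:E.
  apply/cvg_lim => //; rewrite -[X in _ --> X]adde0.
  by apply: cvgeD => //; exact: cvg_cst.
move=> <-; apply: lime_ge; last exact: nearW.
apply/cvg_ex; exists (M%:E + 0); apply: cvgeD => //; exact: cvg_cst.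
Qed.

End metric_outer_measure.

Section hausdorff_measurable.
Context {R : realType} {N : nat}.
Local Notation V := (N.-tuple R).

Lemma hausdorffU_coord s (i : 'I_N) (A B : set V) (a b : R) : a < b ->
  (forall x, A x -> tnth x i <= a) -> (forall x, B x -> b <= tnth x i) ->
  (hausdorff s A + hausdorff s B <= hausdorff s (A `|` B))%E.
Proof.
move=> ab Aa Bb; apply: (@hausdorffU_sep _ _ _ _ _ (b - a)); rewrite ?subr_gt0//.
move=> x y Ax By; apply: le_trans (edist_coord x y i).
by rewrite distrC (le_trans _ (ler_norm _))// lerB// ?Aa ?Bb.
Qed.

(** Measurability of the identity says that all measurable sets are Caratheodory measurable, and in
    this form it need only be checked on the generating half-spaces. *)
Lemma measurable_caratheodory (nu : {outer_measure set (pointed_tuple R N) -> \bar R}) :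
  (forall (i : 'I_N) (A B : set V) (a b : R), a < b ->
    (forall x, A x -> tnth x i <= a) -> (forall x, B x -> b <= tnth x i) ->
    (nu A + nu B <= nu (A `|` B))%E) ->
  measurable_fun [set: caratheodory_type nu] (id : caratheodory_type nu -> V).
Proof.
move=> sep; apply/measurable_fun_tnthP => i.
apply: (measurability _ (RGenOInfty.measurableE R)) => //.
move=> _ [_ [a ->] <-]; rewrite setTI.
have -> : (@tnth N R ^~ i \o id) @^-1` `]a, +oo[ = [set x : V | a < tnth x i].
  by apply/seteqP; split => x /=; rewrite in_itv/= andbT.
apply: (@superlevel_caratheodory _ _ nu (fun x : V => tnth x i)) => A B a' b'.
exact: sep.
Qed.

End hausdorff_measurable.

(** * Scaling and grid covers *)

Lemma outer_measure_big_subadditive (R : realType) (T I : Type)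
    (mu : {outer_measure set T -> \bar R}) (r : seq I) (P : pred I) (F : I -> set T) :
  (mu (\big[setU/set0]_(i <- r | P i) F i) <= \sum_(i <- r | P i) mu (F i))%E.
Proof.
apply: (big_ind2 (fun A x => mu A <= x)%E); rewrite ?outer_measure0//.
by move=> A x B y Ax By; rewrite (le_trans (outer_measureU2 _ _ _))// leeD.
Qed.

Section hausdorff_scaling.
Context {R : realType} {N : nat}.
Local Notation V := (N.-tuple R).
Implicit Types (A : set V) (s : nat).

(** The images of a cover of mesh [d / L] form a cover of mesh [d], each content growing by at most
    [L ^+ s]. *)
Lemma hausdorff_lipschitz s (f : V -> V) (L : R) A : 0 < L ->
  (forall x y, edist (f x) (f y) <= L * edist x y) ->
  (hausdorff s (f @` A) <= (L ^+ s)%:E * hausdorff s A)%E.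
Proof.
move=> L0 fL; apply: ge_hausdorff => d d0.
apply: (@le_trans _ _ ((L ^+ s)%:E * hausdorff_delta s (d / L) A)%E); last first.
  rewrite lee_pmul2l//; first by apply: le_hausdorff_sup; rewrite divr_gt0.
  by rewrite lte_fin exprn_gt0.
rewrite -lee_pdivrMl ?exprn_gt0//.
apply: le_ereal_inf_tmp => _ [F [AF Fd] <-]; rewrite lee_pdivrMl ?exprn_gt0//.
rewrite -nneseriesZl; last by move=> *; exact: hcontent_ge0.
have fdiam U : U !=set0 -> (ediam U <= (d / L)%:E)%E ->
    (ediam (f @` U) <= (L * fine (ediam U))%:E)%E.
  move=> U0 Ud; apply: ge_ediam => _ _ [x Ux <-] [y Uy <-]; rewrite lee_fin.
  rewrite (le_trans (fL _ _))// ler_pM2l// -lee_fin.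
  by rewrite -(ediam_fin U0 Ud) ediam_ub.
apply: (@le_trans _ _ (\sum_(i <oo) hcontent s (f @` F i))%E).
  apply: ereal_inf_lbound; exists (fun i => f @` F i) => //; split.
    by move=> _ [x Ax <-]; have [i _ Fix] := AF _ Ax; exists i => //; exists x.
  move=> i; have [->|/set0P F0] := eqVneq (F i) set0.
    by rewrite image_set0 ediam_set0 leNye.
  apply: (le_trans (fdiam _ F0 (Fd i))); rewrite lee_fin mulrC -ler_pdivlMr//.
  by rewrite -lee_fin -(ediam_fin F0 (Fd i)).
apply: lee_nneseries => [*|i _]; first exact: hcontent_ge0.
have [->|/set0P F0] := eqVneq (F i) set0.
  by rewrite image_set0 !hcontent_set0 mule0.
rewrite (le_trans (le_hcontent _ _ (fdiam _ F0 (Fd i))))//.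
  by rewrite mulr_ge0 ?fine_ediam_ge0// ltW.
by rewrite hcontentE// -EFinM exprMn.
Qed.

Definition affine (m r : R) (x : V) : V := [tuple m + r * tnth x i | i < N].

Lemma tnth_affine m r x i : tnth (affine m r x) i = m + r * tnth x i.
Proof. by rewrite tnth_mktuple. Qed.

Lemma affineK m r : r != 0 -> cancel (affine m r) (affine (- m / r) r^-1).
Proof.
move=> r0 x; apply: eq_from_tnth => i; rewrite !tnth_affine.
by field.
Qed.

Lemma affineVK m r : r != 0 -> cancel (affine (- m / r) r^-1) (affine m r).
Proof.
move=> r0 x; apply: eq_from_tnth => i; rewrite !tnth_affine.
by field.
Qed.

Lemma edist_affine m r x y : 0 <= r ->
  edist (affine m r x) (affine m r y) = r * edist x y.
Proof.
move=> r0; rewrite /edist -[in RHS](ger0_norm r0) -sqrtr_sqr -sqrtrM ?sqr_ge0//.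
rewrite mulr_sumr; congr Num.sqrt; apply: eq_bigr => i _.
by rewrite !tnth_affine; ring.
Qed.

(** Both inequalities are the Lipschitz bound, for the map and for its inverse. *)
Lemma hausdorff_affine s m r A : 0 < r ->
  hausdorff s (affine m r @` A) = ((r ^+ s)%:E * hausdorff s A)%E.
Proof.
move=> r0; apply/eqP; rewrite eq_le; apply/andP; split.
  by apply: hausdorff_lipschitz => // x y; rewrite edist_affine// ltW.
rewrite -lee_pdivlMl ?exprn_gt0// -exprVn.
rewrite -[X in (hausdorff s X <= _)%E](_ : affine (- m / r) r^-1 @` (affine m r @` A) = A).
  apply: hausdorff_lipschitz; rewrite ?invr_gt0// => x y.
  by rewrite edist_affine// invr_ge0 ltW.
rewrite image_comp; apply/seteqP; split => [_ [x Ax <-]|x Ax].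
  by rewrite /= affineK// gt_eqF.
by exists x => //=; rewrite affineK// gt_eqF.
Qed.

Lemma measurable_affine m r : measurable_fun [set: V] (affine m r).
Proof.
apply/measurable_fun_tnthP => i.
rewrite (_ : _ \o _ = fun x : V => m + r * tnth x i); last first.
  by apply/funext => x /=; rewrite tnth_affine.
apply: measurable_funD => //.
by apply: measurable_funM => //; exact: measurable_tnth.
Qed.

(** At most [M * k ^ s] pieces of diameter at most [C / k] have total content at most [M * C ^ s],
    whatever [k] is. *)
Lemma hausdorff_grid_cover s A (M : nat) (C : R) : 0 <= C ->
  (forall k, (0 < k)%N -> exists (I : finType) (D : {set I}) (F : I -> set V),
     [/\ (#|D| <= M * k ^ s)%N,
         (forall x, A x -> exists2 i, i \in D & F i x) &
         (forall i, (ediam (F i) <= (C / k%:R)%:E)%E)]) ->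
  (hausdorff s A <= (M%:R * C ^+ s)%:E)%E.
Proof.
move=> C0 cover; apply: ge_hausdorff => d d0.
pose k := (Num.truncn (C / d)).+1.
have kd : C / k%:R <= d.
  by rewrite ler_pdivrMr// mulrC -ler_pdivrMr// ltW// truncnS_gt.
have [I [D [F [cardD AF Fd]]]] := cover k isT.
have AF' : A `<=` \big[setU/set0]_(i in D) F i.
  by move=> x /AF[i iD Fix]; rewrite (bigD1 i)//=; left.
apply: (le_trans (le_outer_measure (hausdorff_delta s d) _ _ AF')).
apply: (le_trans (outer_measure_big_subadditive _ _ _ _)).
apply: (@le_trans _ _ (\sum_(i in D) ((C / k%:R) ^+ s)%:E)%E).
  apply: lee_sum => i _; apply: le_trans (le_hcontent s _ (Fd i)).
    by apply: hausdorff_delta_le_hcontent; rewrite (le_trans (Fd i))// lee_fin.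
  by rewrite divr_ge0.
rewrite sumEFin lee_fin sumr_const -[leLHS]mulr_natl expr_div_n.
apply: (@le_trans _ _ ((M * k ^ s)%:R * (C ^+ s / k%:R ^+ s))).
  by rewrite ler_wpM2r ?ler_nat// divr_ge0// exprn_ge0.
by rewrite natrM natrX mulrACA mulfV ?mulr1// expf_neq0// pnatr_eq0.
Qed.

End hausdorff_scaling.

(** * The unit surface has finite Hausdorff measure *)

Section unit_sphere_finite.
Context {R : realType} {s : nat}.
Local Notation N := s.+2.
Local Notation V := (N.-tuple R).
Local Notation S := (@MCsurface R N 0 1).

Lemma MCsurface_bound (y : V) i : S y -> `|tnth y i| <= N%:R.
Proof.
case=> _; rewrite mul1r => yN.
have : tnth y i ^+ 2 <= N%:R.
  by rewrite -yN (bigD1 i)//= lerDl sumr_ge0// => *; exact: sqr_ge0.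
rewrite -real_normK ?num_real//.
have := normr_ge0 (tnth y i); have : 1 <= N%:R :> R by rewrite ler1n.
move: (N%:R) `|_| => n t; nra.
Qed.

(** The squares average to 1, so some coordinate has modulus at least 1. The coordinates sum to 0,
    so another one is zero or of opposite sign. *)
Lemma MCsurface_spread (y : V) : S y -> exists a b, 1 <= tnth y a - tnth y b.
Proof.
case; rewrite mul0r mul1r => y0 yN.
have [i yi] : exists i, 1 <= tnth y i ^+ 2.
  apply: contrapT => /forallNP yi; suff : N%:R < N%:R :> R by rewrite ltxx.
  rewrite -[ltLHS]yN -[ltRHS]mulr1 mulr_natl -[X in _ *+ X](card_ord N) -sumr_const.
  apply: ltr_sum; last by move=> i _; rewrite ltNge; apply/negP/yi.
  by apply/hasP; exists ord0 => //; rewrite mem_index_enum.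
have sign (t : R) : 1 <= t ^+ 2 -> 1 <= t \/ t <= -1.
  by move=> t1; have [|] := leP 0 t => t0; [left|right]; nra.
have [{}yi|{}yi] := sign _ yi.
  have [j yj] : exists j, tnth y j <= 0.
    apply: contrapT => /forallNP yj; move: y0; apply/eqP; rewrite gt_eqF//.
    rewrite (bigD1 ord0)//= ltr_pwDl//; first by rewrite ltNge; apply/negP/yj.
    by rewrite sumr_ge0// => k _; rewrite ltW// ltNge; apply/negP/yj.
  by exists i, j; lra.
have [j yj] : exists j, 0 <= tnth y j.
  apply: contrapT => /forallNP yj; move: y0; apply/eqP; rewrite lt_eqF//.
  rewrite -oppr_gt0 -sumrN (bigD1 ord0)//= ltr_pwDl//.
    by rewrite oppr_gt0 ltNge; apply/negP/yj.
  by rewrite sumr_ge0// => k _; rewrite oppr_ge0 ltW// ltNge; apply/negP/yj.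
by exists j, i; lra.
Qed.

(* On the piece of the sphere where [y_a - y_b >= 1], the two constraints express
   [y_a] and [y_b] as Lipschitz functions of the other [s] coordinates, via
   [(y_a - y_b)^2 = 2 (y_a^2 + y_b^2) - (y_a + y_b)^2]. *)
Lemma MCsurface_chart (a b : 'I_N) (y z : V) (e : R) : 0 <= e -> S y -> S z ->
  1 <= tnth y a - tnth y b -> 1 <= tnth z a - tnth z b ->
  (forall i, i != a -> i != b -> `|tnth y i - tnth z i| <= e) ->
  forall i, `|tnth y i - tnth z i| <= 4 * N%:R ^+ 2 * e.
Proof.
move=> e0 Sy Sz yab zab yze.
have N1 : 1 <= N%:R :> R by rewrite ler1n.
have ba : b != a.
  by apply/eqP => ba; move: yab; rewrite ba subrr; apply/negP; rewrite -ltNge.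
have other (f : 'I_N -> R) (M : R) : 0 <= M ->
    (forall i, i != a -> i != b -> `|f i| <= M) ->
    `|\sum_(i < N | (i != a) && (i != b)) f i| <= N%:R * M.
  move=> M0 fM; rewrite (le_trans (ler_norm_sum _ _ _))//.
  apply: (@le_trans _ _ (\sum_(i < N) M)); last first.
    by rewrite sumr_const card_ord mulr_natl.
  rewrite big_mkcond; apply: ler_sum => i _.
  by case: ifP => // /andP[ia ib]; exact: fM.
have split2 (f : 'I_N -> R) : \sum_(i < N) f i =
    f a + (f b + \sum_(i < N | (i != a) && (i != b)) f i).
  by rewrite (bigD1 a)//= (bigD1 b).
have d1 := other (fun i => tnth y i - tnth z i) e e0 yze.
have d2 : `|\sum_(i < N | (i != a) && (i != b)) (tnth y i ^+ 2 - tnth z i ^+ 2)|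
    <= N%:R * (2 * N%:R * e).
  apply: other => [|i ia ib]; first by rewrite !mulr_ge0.
  rewrite subr_sqr normrM mulrC ler_pM// ?yze//.
  rewrite (le_trans (ler_normD _ _))// mulr_natl mulr2n lerD//; exact: MCsurface_bound.
have ya := MCsurface_bound a Sy; have yb := MCsurface_bound b Sy.
have za := MCsurface_bound a Sz; have zb := MCsurface_bound b Sz.
move: ya yb za zb; rewrite !ler_norml => ya yb za zb.
move: d1 d2; rewrite !sumrB.
case: Sy => + +; case: Sz => + +; rewrite !split2 mul0r mul1r.
move: (\sum_(i < N | _) tnth y i) (\sum_(i < N | _) tnth z i) => u u'.
move: (\sum_(i < N | _) tnth y i ^+ 2) (\sum_(i < N | _) tnth z i ^+ 2) => w w'.
move: N1 ya yb za zb yab zab {other split2}; move: (N%:R : R) => n.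
set p := tnth y a; set q := tnth y b; set p' := tnth z a; set q' := tnth z b.
move=> n1 hp hq hp' hq' D1 D1' z1 z2 y1 y2 du dw.
have nn : n * e <= n ^+ 2 * e by rewrite ler_wpM2r// expr2 ler_peMl//; lra.
have key : `|p - p'| <= 4 * n ^+ 2 * e /\ `|q - q'| <= 4 * n ^+ 2 * e.
  (* The linear constraint controls [p + q], and the quadratic one then controls [(p - q) ^+ 2]. *)
  have hA : `|(p + q) - (p' + q')| <= n * e.
    by rewrite (_ : _ - _ = - (u - u')) ?normrN//; lra.
  have hS : `|(p + q) + (p' + q')| <= 4 * n by rewrite ler_norml; lra.
  have hD : `|((p - q) - (p' - q')) * ((p - q) + (p' - q'))| <= 8 * n ^+ 2 * e.
    rewrite (_ : _ * _ = - 2 * (w - w') -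
      ((p + q) + (p' + q')) * ((p + q) - (p' + q'))); last by nra.
    rewrite (le_trans (ler_normB _ _))// !normrM normrN (ger0_norm (ler0n R 2)).
    have := ler_pM (normr_ge0 _) (normr_ge0 _) hS hA.
    by move: dw; rewrite -normrM; move: `|_| `|_| => x1 x2; lra.
  (* The other factor in [hD] is at least 2, since both differences are at least 1. *)
  have hD2 : `|(p - q) - (p' - q')| <= 4 * n ^+ 2 * e.
    move: hD; rewrite normrM (@ger0_norm _ (p - q + (p' - q'))); last by lra.
    have := normr_ge0 ((p - q) - (p' - q')).
    by move: `|_| => x; nra.
  by move: hA hD2; rewrite !ler_norml; split; lra.
move=> i; have [->|ia] := eqVneq i a; first exact: key.1.
have [->|ib] := eqVneq i b; first exact: key.2.
rewrite (le_trans (yze _ ia ib))// ler_peMl//; nra.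
Qed.

(** Finitely many pieces cover the surface. A grid on the [s] free coordinates cuts each piece into
    cells whose diameter is controlled by the chart. *)
Lemma hausdorff_MCsurface_lty : (hausdorff s S < +oo)%E.
Proof.
pose piece (p : 'I_N * 'I_N) : set V := S `&` [set y | 1 <= tnth y p.1 - tnth y p.2].
have [n nE] : exists n : R, n = N%:R by exists N%:R.
have n0 : 0 <= n by rewrite nE.
have Sn y j : S y -> - n <= tnth y j <= n.
  by move=> Sy; rewrite nE -ler_norml; exact: MCsurface_bound.
(* Coordinates lie in an interval of length [2 * n]. The extra 1 keeps [rescale] strictly below the
   number of cells, so that [inord] does not truncate. *)
pose w : R := 2 * n + 1.
have w0 : 0 < w by rewrite ltr_wpDl// mulr_ge0.
have piece_fin p : (hausdorff s (piece p) <=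
    (1%:R * (n * (4 * n ^+ 2 * w)) ^+ s)%:E)%E.
  case: p => a b; apply: hausdorff_grid_cover.
    by rewrite !mulr_ge0// ltW.
  case=> // k _.
  pose rescale (y : V) j := (tnth y j + n) / w * k.+1%:R.
  pose cell y j : 'I_k.+1 := inord (Num.truncn (rescale y j)).
  have rescale_itv y j : S y -> 0 <= rescale y j < k.+1%:R.
    move=> Sy; have /andP[y0 y1] := Sn _ j Sy.
    have yn : 0 <= tnth y j + n by lra.
    rewrite mulr_ge0 ?divr_ge0 ?(ltW w0)//= gtr_pMl// ltr_pdivrMr// mul1r /w; lra.
  have cellE y z j : S y -> S z -> cell y j = cell z j ->
      `|tnth y j - tnth z j| <= w / k.+1%:R.
    move=> Sy Sz /(congr1 val) /=; have /andP[y0 y1] := rescale_itv _ j Sy.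
    have /andP[z0 z1] := rescale_itv _ j Sz.
    have /andP[ty0 ty1] := truncn_itv y0; have /andP[tz0 tz1] := truncn_itv z0.
    rewrite !inordK.
    - move=> tyz; rewrite tyz in ty0 ty1.
      have : `|rescale y j - rescale z j| <= 1.
        by move: ty0 ty1 tz0 tz1; rewrite -natr1 ler_norml; lra.
      rewrite /rescale -mulrBl -mulrBl (_ : _ - _ = tnth y j - tnth z j); last by ring.
      rewrite !normrM normfV (gtr0_norm w0) (@ger0_norm _ k.+1%:R)//.
      by rewrite -ler_pdivlMr// ler_pdivrMr// mul1r mulrC.
    - by rewrite -(ltr_nat R) (le_lt_trans tz0).
    - by rewrite -(ltr_nat R) (le_lt_trans ty0).
  exists {ffun 'I_N -> 'I_k.+1}.
  (* For [a = b] the piece is empty. *)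
  have [<-|ab] := eqVneq a b.
    exists finset.set0, (fun=> set0); split; first by rewrite cards0.
      by move=> y [_ /=]; rewrite subrr ler10.
    by move=> ?; rewrite ediam_set0 leNye.
  (* Fixing the cell index to [ord0] at [a] and [b] leaves [s] free indices, which gives the
     exponent [s] in the number of cells. *)
  exists [set f in pffun_on ord0 (~: [set a; b])%SET predT].
  exists (fun f : {ffun 'I_N -> 'I_k.+1} => piece (a, b) `&`
    [set y | forall j, j != a -> j != b -> cell y j = f j]); split.
  - rewrite mul1n cardsE card_pffun_on card_ord.
    by rewrite cardsCs finset.setCK cards2 ab card_ord subn2.
  - move=> y Py; exists [ffun j => if (j == a) || (j == b) then ord0 else cell y j].
      rewrite inE; apply/pffun_onP; split => //.
      apply/fintype.subsetP => j; rewrite !inE ffunE; apply: contraNN.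
      by move=> ->.
    split => // j ja jb; rewrite ffunE (negbTE ja) (negbTE jb)//.
  - move=> f; apply: ge_ediam => y z [[Sy y1] yf] [[Sz z1] zf].
    rewrite lee_fin [leRHS](_ : _ = n * (4 * n ^+ 2 * (w / k.+1%:R))); last by ring.
    rewrite nE; apply: edist_sup; first by rewrite !mulr_ge0 ?divr_ge0// ltW.
    apply: (MCsurface_chart _ Sy Sz y1 z1); first by rewrite divr_ge0// ltW.
    by move=> j ja jb; apply: cellE => //; rewrite yf// zf.
have SP : S `<=` \big[setU/set0]_p piece p.
  move=> y Sy; have [a [b yab]] := MCsurface_spread Sy.
  by rewrite (bigD1 (a, b))//=; left.
apply: (le_lt_trans (le_outer_measure (hausdorff s) _ _ SP)).
apply: (le_lt_trans (outer_measure_big_subadditive _ _ _ _)).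
apply: (le_lt_trans (lee_sum _ (fun p _ => piece_fin p))).
by rewrite sumEFin ltry.
Qed.

End unit_sphere_finite.

(** * The unit surface has positive Hausdorff measure *)

Section box_cover.
Context {R : realType}.

(* Weights make the induction on the dimension go through: freezing the last
   coordinate at [t] multiplies the weight of each box by the indicator of its last
   side at [t], and integrating over [t] in [0, 1] restores the missing factor. *)
Lemma box_cover_sum (s : nat) (w : nat -> R) (a : nat -> nat -> R) (d : nat -> R) :
  (forall i, 0 <= w i) -> (forall i, 0 <= d i) ->
  (forall x : nat -> R, (forall j, (j < s)%N -> 0 <= x j <= 1) ->
    (1 <= \sum_(i <oo)
      (w i * \prod_(j < s) \1_(`[a i j, a i j + d i]%classic) (x j))%:E)%E) ->
  (1 <= \sum_(i <oo) (w i * d i ^+ s)%:E)%E.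
Proof.
elim: s w => [|s IH] w w0 d0 cover.
  apply: (le_trans (cover (fun=> 0) (fun _ _ => _))) => //.
  by apply: lee_nneseries => [*|i _]; rewrite !big_ord0 ?expr0 ?lee_fin// mulr1.
pose I i := `[a i s, a i s + d i]%classic.
have slice (t : R) : t \in `[0, 1] ->
    (1 <= \sum_(i <oo) (w i * d i ^+ s)%:E * (\1_(I i) t)%:E)%E.
  move=> t01; rewrite (eq_eseriesr (g := fun i => ((w i * \1_(I i) t) * d i ^+ s)%:E)).
    apply: IH => // [i|x x01]; first by rewrite mulr_ge0.
    pose x' j := if (j < s)%N then x j else t.
    have := cover x'; rewrite /x' => /(_ _)/le_trans; apply.
      move=> j _; case: ifPn => [/x01//|_]; by move: t01; rewrite in_itv.
    apply: lee_nneseries => [i _ _|i _]; rewrite lee_fin.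
      by rewrite mulr_ge0// prodr_ge0.
    rewrite big_ord_recr/= ltnn -[leRHS]mulrA [X in _ <= _ * X]mulrC.
    by under eq_bigr do rewrite ltn_ord.
  by move=> i _; rewrite -EFinM mulrAC.
have mI i : measurable (I i) by exact: measurable_itv.
pose mu := @lebesgue_measure R.
pose D : set R := `[0, 1]%classic.
have mD : measurable D by exact: measurable_itv.
have muD : mu D = 1%E.
  by rewrite /mu /D lebesgue_measure_itv/= lte_fin ltr01 oppr0 adde0.
pose g i : R -> \bar R := fun t => ((w i * d i ^+ s)%:E * (\1_(I i) t)%:E)%E.
pose h i : R -> \bar R := fun t => (\1_(I i) t)%:E.
have mi i : measurable_fun D (h i).
  by apply/measurable_EFinP; exact: measurable_indic.
have mg i : measurable_fun D (g i).
  by apply: emeasurable_funM => //; exact: mi.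
have g0 i t : (0 <= g i t)%E.
  by rewrite /g -EFinM lee_fin !mulr_ge0// exprn_ge0.
(* Integrate [slice] over the unit interval and exchange sum and integral; each indicator
   contributes at most the side [d i]. *)
have : (\int[mu]_(t in D) 1 <=
    \int[mu]_(t in D) \sum_(i <oo) g i t)%E.
  apply: ge0_le_integral => //.
  by apply: (@ge0_emeasurable_sum _ _ _ D g xpredT) => //.
rewrite integral_cst// mul1e [X in (X <= _)%E -> _]muD => /le_trans; apply.
rewrite integral_nneseries//.
apply: lee_nneseries => [i _ _|i _]; first by apply: integral_ge0.
rewrite ge0_integralZl//; last 2 first.
- exact: mi.
- by rewrite lee_fin mulr_ge0// exprn_ge0.
rewrite integral_indic//; last exact: mI.
rewrite exprSr mulrA [leRHS]EFinM lee_wpmul2l ?lee_fin ?mulr_ge0 ?exprn_ge0//.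
apply: (@le_trans _ _ (mu (I i))); first apply: le_measure.
- by rewrite inE; apply: measurableI; [exact: mI|exact: mD].
- by rewrite inE; exact: mI.
- by move=> x [].
rewrite /mu lebesgue_measure_itv/= lte_fin; case: ifP => _; rewrite ?lee_fin//.
by rewrite addrAC subrr add0r.
Qed.

End box_cover.

Section unit_sphere_positive.
Context {R : realType} {s : nat}.
Local Notation N := s.+2.
Local Notation V := (N.-tuple R).
Local Notation S := (@MCsurface R N 0 1).

(** The last two coordinates must have sum [- sg] and sum of squares [N - q]. They are the roots of
    a quadratic with discriminant [r ^+ 2], which is nonnegative because [q <= sg <= 1] and
    [2 <= N]. *)
Lemma MCsurface_projection (u : nat -> R) :
  (forall j, (j < s)%N -> 0 <= u j <= N%:R^-1) ->
  exists2 y : V, S y & forall i : 'I_N, (i < s)%N -> tnth y i = u i.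
Proof.
move=> u01.
pose sg := \sum_(j < s) u j; pose q := \sum_(j < s) u j ^+ 2.
have N0 : 0 < N%:R :> R by [].
have u1 j : (j < s)%N -> u j <= 1.
  move=> /u01/andP[_ /le_trans]; apply; rewrite invf_le1// ler1n//.
have sg0 : 0 <= sg by apply: sumr_ge0 => j _; have /andP[] := u01 _ (ltn_ord j).
have sg1 : sg <= 1.
  apply: (@le_trans _ _ (\sum_(j < s) N%:R^-1)).
    by apply: ler_sum => j _; have /andP[] := u01 _ (ltn_ord j).
  rewrite sumr_const card_ord -[leLHS]mulr_natl ler_pdivrMr// mul1r ler_nat.
  by rewrite ltnW.
have qsg : q <= sg.
  apply: ler_sum => j _; have /andP[uj0 _] := u01 _ (ltn_ord j).
  by rewrite expr2 ler_piMr// u1.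
pose r := Num.sqrt (2 * (N%:R - q) - sg ^+ 2).
have r2 : r ^+ 2 = 2 * (N%:R - q) - sg ^+ 2.
  rewrite sqr_sqrtr//; have : 2 <= N%:R :> R by rewrite ler_nat.
  by move: (N%:R : R) => n; nra.
exists [tuple if (i < s)%N then u i else if i == s :> nat then (- sg + r) / 2
                                                else (- sg - r) / 2 | i < N].
  split; rewrite !big_ord_recr/= !tnth_mktuple/= ltnn eqxx ltnNge leqnSn/= gtn_eqF//.
    rewrite (eq_bigr (fun j : 'I_s => u j)); last first.
      by move=> j _; rewrite tnth_mktuple/= ltn_ord.
    by rewrite -/sg; move: (N%:R : R) => n; field.
  rewrite (eq_bigr (fun j : 'I_s => u j ^+ 2)); last first.
    by move=> j _; rewrite tnth_mktuple/= ltn_ord.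
  rewrite -/q mul1r; move: r2; move: (N%:R : R) => n r2; nra.
by move=> i; rewrite tnth_mktuple => ->.
Qed.

(** Each covering set projects into a box of side twice its diameter around one of its points.
    Divided by [c], these boxes cover the unit cube, so the total content is at least
    [(c / 2) ^+ s]. *)
Lemma hausdorff_MCsurface_gt0 : (0 < hausdorff s S)%E.
Proof.
pose c : R := N%:R^-1; have c0 : 0 < c by rewrite invr_gt0.
apply: (@lt_le_trans _ _ ((c / 2) ^+ s)%:E); first by rewrite lte_fin exprn_gt0// divr_gt0.
apply: le_trans (le_hausdorff_sup s S ltr01).
apply: le_ereal_inf_tmp => _ [F [SF Fd] <-].
pose p i : V := xget [tuple 0 | _ < N] (F i).
(* Weight 0 discards empty sets also for [s = 0], where a zero side to the power [s] would count as
   1. *)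
pose w i : R := if `[< F i !=set0 >] then 1 else 0.
pose e i : R := fine (ediam (F i)).
have e0 i : 0 <= e i.
  have [F0|/set0P F0] := eqVneq (F i) set0; last exact: fine_ediam_ge0.
  by rewrite /e F0 ediam_set0.
have w0 i : 0 <= w i by rewrite /w; case: asboolP.
have := @box_cover_sum R s w (fun i j => (tnth (p i) (inord j) - e i) / c)
  (fun i => 2 / c * e i) w0.
have -> : (\sum_(i <oo) (w i * (2 / c * e i) ^+ s)%:E)%E =
    (((2 / c) ^+ s)%:E * \sum_(i <oo) hcontent s (F i))%E.
  rewrite -nneseriesZl; last by move=> *; exact: hcontent_ge0.
  apply: eq_eseriesr => i _; rewrite /w; case: asboolP => F0.
    by rewrite hcontentE// -EFinM mul1r exprMn.
  by have [->|/set0P//] := eqVneq (F i) set0; rewrite hcontent_set0 mule0 mul0r.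
have c2 : 0 < 2 / c by rewrite divr_gt0.
move=> cover; have {}cover : (1 <= ((2 / c) ^+ s)%:E * \sum_(i <oo) hcontent s (F i))%E.
  apply: cover => [i|x x01]; first by rewrite mulr_ge0// ltW.
  have [|y Sy yx] := @MCsurface_projection (fun j => c * x j).
    move=> j /x01/andP[x0 x1]; rewrite mulr_ge0 ?(ltW c0)//=.
    by rewrite ler_piMr// ltW.
  have [i _ Fiy] := SF _ Sy.
  (* The single box of a set [F i] containing [y] already contributes 1. *)
  rewrite (@nneseriesD1 _ _ i)//; last first.
    by move=> k _; rewrite lee_fin mulr_ge0// prodr_ge0.
  rewrite big1 => [|j _].
    have -> : w i = 1 by rewrite /w asboolT//; exists y.
    rewrite mulr1 leeDl// nneseries_ge0// => k _ _.
    by rewrite lee_fin mulr_ge0// prodr_ge0.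
  rewrite indicE mem_set//= in_itv/=.
  have Fip : F i (p i) by apply: xgetPex; exists y.
  have := edist_coord (p i) y (inord j).
  have jN : (j < N)%N by rewrite (leq_trans (ltn_ord j))// -addn2 leq_addr.
  rewrite yx inordK//.
  have : edist (p i) y <= e i.
    rewrite -lee_fin -(ediam_fin _ (Fd i)); last by exists y.
    exact: ediam_ub.
  move=> + /le_trans h => /h; rewrite ler_norml => /andP[h1 h2].
  rewrite ler_pdivrMr//; apply/andP; split; first by lra.
  rewrite -mulrA (mulrC c^-1) mulrA -mulrDl ler_pdivlMr//; lra.
move: cover; rewrite -(@lee_pmul2l _ ((c / 2) ^+ s)%:E)//; last first.
  by rewrite lte_fin exprn_gt0// divr_gt0.
rewrite mule1 muleA -EFinM -exprMn (_ : c / 2 * (2 / c) = 1) ?expr1n ?mul1e//.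
by field; rewrite gt_eqF.
Qed.

End unit_sphere_positive.

(** * The uniform probability on the unit surface *)

Section two_map_mixture.
Context d d' (T : measurableType d) (T' : measurableType d') (R : realType).
Variables (P : probability T R) (g1 g2 : {mfun T >-> T'}).

Let half : {nonneg R} := (2^-1)%:nng.

Definition mixture : set T' -> \bar R :=
  measure_add (mscale half (distribution P g1)) (mscale half (distribution P g2)).

HB.instance Definition _ := Measure.on mixture.

Lemma mixtureE A : mixture A =
  ((2^-1)%:E * P (g1 @^-1` A) + (2^-1)%:E * P (g2 @^-1` A))%E.
Proof. by rewrite /mixture measure_addE. Qed.

Let mixture_setT : mixture setT = 1%E.
Proof.
rewrite mixtureE !preimage_setT probability_setT !mule1 -EFinD.
by congr EFin; field.
Qed.

HB.instance Definition _ := Measure_isProbability.Build _ _ _ mixture mixture_setT.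

End two_map_mixture.

Section uniform_probability.
Context {R : realType} {s : nat}.
Local Notation N := s.+2.
Local Notation V := (N.-tuple R).
Implicit Types (A B : set V).

(** This is the reference measure. It is made an outer measure first, to apply Caratheodory's
    theorem, and then a probability. *)
Definition uniform01 : set V -> \bar R := muMC_m 0 1.

Lemma uniform01E A : uniform01 A = (hausdorff s (A `&` MCsurface 0 1) *
  ((fine (hausdorff s (@MCsurface R N 0 1)))^-1)%:E)%E.
Proof. by rewrite /uniform01 /muMC_m subSS subSS subn0. Qed.

Let k := (fine (hausdorff s (@MCsurface R N 0 1)))^-1.

Let k0 : 0 <= k.
Proof. by rewrite invr_ge0 fine_ge0// hausdorff_ge0. Qed.

Lemma uniform01_set0 : uniform01 set0 = 0%E.
Proof. by rewrite uniform01E set0I hausdorff0 mul0e. Qed.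

Lemma uniform01_ge0 A : (0 <= uniform01 A)%E.
Proof. by rewrite uniform01E mule_ge0 ?hausdorff_ge0// lee_fin k0. Qed.

Let uniform01_le A B : A `<=` B -> (uniform01 A <= uniform01 B)%E.
Proof.
move=> AB; rewrite !uniform01E lee_wpmul2r ?lee_fin ?k0//.
by apply: le_hausdorff; exact: setSI.
Qed.

Let uniform01_sigma_subadditive : sigma_subadditive uniform01.
Proof.
move=> F; rewrite uniform01E setI_bigcupl.
under eq_eseriesr do rewrite uniform01E muleC.
rewrite nneseriesZl; last by move=> *; exact: hausdorff_ge0.
by rewrite muleC lee_wpmul2l ?lee_fin ?k0//; exact: hausdorff_sigma_subadditive.
Qed.

HB.instance Definition _ := isOuterMeasure.Build R (pointed_tuple R N) uniform01
  uniform01_set0 uniform01_ge0 uniform01_le uniform01_sigma_subadditive.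

Let uniform01U_coord (i : 'I_N) A B (a b : R) : a < b ->
  (forall x, A x -> tnth x i <= a) -> (forall x, B x -> b <= tnth x i) ->
  (uniform01 A + uniform01 B <= uniform01 (A `|` B))%E.
Proof.
move=> ab Aa Bb; rewrite !uniform01E -ge0_muleDl ?hausdorff_ge0//.
rewrite lee_wpmul2r ?lee_fin ?k0// setIUl.
by apply: (@hausdorffU_coord _ _ _ i _ _ a b) => // x [] *; [exact: Aa|exact: Bb].
Qed.

Let uniform01_measurable A : measurable A -> uniform01.-caratheodory A.
Proof.
move=> mA; rewrite -[A]setTI.
exact: (@measurable_caratheodory R N uniform01 uniform01U_coord measurableT A mA).
Qed.

Let uniform01_sigma_additive : semi_sigma_additive uniform01.
Proof.
move=> F mF tF mUF.
by apply: (@caratheodory_measure_sigma_additive R (pointed_tuple R N) uniform01) => //;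
  [move=> i; exact: uniform01_measurable|exact: uniform01_measurable].
Qed.

HB.instance Definition _ := isMeasure.Build _ V R uniform01
  uniform01_set0 uniform01_ge0 uniform01_sigma_additive.

Lemma hausdorff_MCsurface_fin : hausdorff s (@MCsurface R N 0 1) \is a fin_num.
Proof. by rewrite ge0_fin_numE ?hausdorff_ge0// hausdorff_MCsurface_lty. Qed.

(** Normalization requires the total mass to be finite and nonzero: [fine] sends infinity to 0, and
    so does the inverse with 0. *)
Let uniform01_setT : uniform01 setT = 1%E.
Proof.
rewrite uniform01E setTI -[X in (X * _)%E](fineK hausdorff_MCsurface_fin) -EFinM mulfV//.
rewrite gt_eqF// fine_gt0// hausdorff_MCsurface_gt0.
by rewrite hausdorff_MCsurface_lty.
Qed.

HB.instance Definition _ := Measure_isProbability.Build _ V R uniform01 uniform01_setT.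

Lemma uniform01_disjoint A : (forall x, MCsurface 0 1 x -> ~ A x) -> uniform01 A = 0%E.
Proof.
move=> SA; rewrite uniform01E (_ : _ `&` _ = set0) ?hausdorff0 ?mul0e//.
by apply/seteqP; split => // x [Ax /SA].
Qed.

Lemma sum_affine (m r : R) (x : V) :
  \sum_(i < N) tnth (affine m r x) i = m * N%:R + r * \sum_(i < N) tnth x i.
Proof.
under eq_bigr do rewrite tnth_affine.
by rewrite big_split/= -mulr_sumr sumr_const card_ord mulr_natr.
Qed.

Lemma sum_sqr_affine (m r : R) (x : V) :
  \sum_(i < N) tnth (affine m r x) i ^+ 2 = m ^+ 2 * N%:R +
    2 * m * r * \sum_(i < N) tnth x i + r ^+ 2 * \sum_(i < N) tnth x i ^+ 2.
Proof.
have -> : m ^+ 2 * N%:R = \sum_(i < N) m ^+ 2 by rewrite sumr_const card_ord mulr_natr.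
rewrite !mulr_sumr -!big_split/=; apply: eq_bigr => i _; rewrite tnth_affine; ring.
Qed.

Lemma MCsurface_affine (m rho : R) : m ^+ 2 < rho ->
  forall x : V, MCsurface m rho (affine m (Num.sqrt (rho - m ^+ 2)) x) <-> MCsurface 0 1 x.
Proof.
move=> mrho x; have rho0 : 0 < rho - m ^+ 2 by rewrite subr_gt0.
have r0 : 0 < Num.sqrt (rho - m ^+ 2) by rewrite sqrtr_gt0.
have r2 := sqr_sqrtr (ltW rho0); move: r0 r2; set r := Num.sqrt _ => r0 r2.
rewrite /MCsurface/= sum_affine sum_sqr_affine mul0r mul1r r2.
split=> [[h1 h2]|[-> ->]]; last by split; ring.
have x0 : \sum_(i < N) tnth x i = 0.
  by apply: (mulfI (lt0r_neq0 r0)); rewrite mulr0; lra.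
by split => //; apply: (mulfI (lt0r_neq0 rho0)); move: h2; rewrite x0; lra.
Qed.

(** The scaling factor [r ^+ s] of the Hausdorff measure appears in both numerator and
    normalization, and cancels. *)
Lemma muMC_m_affine (m rho : R) A : m ^+ 2 < rho ->
  muMC_m m rho A = uniform01 (affine m (Num.sqrt (rho - m ^+ 2)) @^-1` A).
Proof.
move=> mrho; have rho0 : 0 < rho - m ^+ 2 by rewrite subr_gt0.
have r0 : 0 < Num.sqrt (rho - m ^+ 2) by rewrite sqrtr_gt0.
have SE := MCsurface_affine mrho.
move: r0 SE; set r := Num.sqrt _ => r0 SE.
have imE B : B `&` MCsurface m rho =
    affine m r @` (affine m r @^-1` B `&` MCsurface 0 1).
  apply/seteqP; split => [x [Bx Sx]|_ [x [Bx Sx] <-]]; last first.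
    by split => //; apply/SE.
  exists (affine (- m / r) r^-1 x); last by rewrite affineVK// gt_eqF.
  split; first by rewrite /preimage/= affineVK// gt_eqF.
  by apply/SE; rewrite affineVK// gt_eqF.
rewrite /muMC_m uniform01E subSS subSS subn0 imE hausdorff_affine//.
rewrite -[MCsurface m rho]setTI imE hausdorff_affine// preimage_setT setTI.
have HA : hausdorff s (affine m r @^-1` A `&` MCsurface 0 1) \is a fin_num.
  rewrite ge0_fin_numE ?hausdorff_ge0//.
  by apply: le_lt_trans hausdorff_MCsurface_lty; apply: le_hausdorff; exact: subIsetr.
rewrite -(fineK HA) -(fineK hausdorff_MCsurface_fin) -!EFinM/=; congr EFin.
have : fine (hausdorff s (@MCsurface R N 0 1)) != 0.
  by rewrite gt_eqF// fine_gt0// hausdorff_MCsurface_gt0 hausdorff_MCsurface_lty.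
have : r ^+ s != 0 by rewrite expf_neq0// gt_eqF.
by move: (r ^+ s) (fine _) (fine _) => x y z x0 y0; field; rewrite x0 y0.
Qed.

End uniform_probability.

(** * The transport cost *)

(** The squared chord is [2 * (rho - P)], and [diffE] also contains the factor [rho - P]. Without it
    there remains [key], which follows from [P * Q >= rho * m * r] and [P <= rho]. *)
Lemma chord_le (R : realFieldType) (rho m r m' r' : R) : 0 < rho ->
  0 <= m -> 0 <= r -> 0 <= m' -> 0 <= r' ->
  m ^+ 2 + r ^+ 2 = rho -> m' ^+ 2 + r' ^+ 2 = rho ->
  ((m - m') ^+ 2 + (r - r') ^+ 2) * (m ^+ 2 * r ^+ 2) <=
  rho * (m ^+ 2 - m' ^+ 2) ^+ 2.
Proof.
move=> rho0 m0 r0 m'0 r'0 mr mr'.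
(* with (m, r) = sqrt rho (sin t, cos t), P = rho cos(t - t'), Q = rho sin(t + t') *)
pose P := m * m' + r * r'; pose Q := m * r' + m' * r.
have P0 : 0 <= P by rewrite addr_ge0// mulr_ge0.
have Q0 : 0 <= Q by rewrite addr_ge0// mulr_ge0.
have c0E : (m - m') ^+ 2 + (r - r') ^+ 2 = 2 * (rho - P).
  have rhoE : 2 * rho = m ^+ 2 + r ^+ 2 + (m' ^+ 2 + r' ^+ 2) by lra.
  by rewrite mulrBr rhoE /P; ring.
have Prho : P <= rho.
  by have := sqr_ge0 (m - m'); have := sqr_ge0 (r - r'); lra.
have diffE : rho ^+ 2 * (m ^+ 2 - m' ^+ 2) ^+ 2 = (rho ^+ 2 - P ^+ 2) * Q ^+ 2.
  have -> : rho ^+ 2 - P ^+ 2 = (m * r' - m' * r) ^+ 2.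
    by rewrite expr2 -{1}mr -{1}mr' /P; ring.
  by rewrite -!exprMn; congr (_ ^+ 2); rewrite mulrBr -{1}mr' -{1}mr /Q; ring.
have PQ : P * Q = rho * (m * r + m' * r').
  transitivity ((m' ^+ 2 + r' ^+ 2) * (m * r) + (m ^+ 2 + r ^+ 2) * (m' * r')).
    by rewrite /P /Q; ring.
  by rewrite mr mr'; ring.
have PQ2 : rho ^+ 2 * (m ^+ 2 * r ^+ 2) <= P ^+ 2 * Q ^+ 2.
  have h0 : 0 <= rho * (m * r) by rewrite !mulr_ge0// ltW.
  have h : rho * (m * r) <= rho * (m * r + m' * r').
    by rewrite ler_pM2l// lerDl mulr_ge0.
  by rewrite -!exprMn PQ lerXn2r ?nnegrE// (le_trans h0 h).
have rhoP : 2 * P ^+ 2 <= rho * (rho + P) by nra.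
have key : 2 * rho * (m ^+ 2 * r ^+ 2) <= (rho + P) * Q ^+ 2.
  rewrite -(ler_pM2l rho0); apply: (@le_trans _ _ (2 * P ^+ 2 * Q ^+ 2)).
    by move: PQ2; lra.
  by rewrite [leRHS]mulrA ler_wpM2r// sqr_ge0.
rewrite c0E -(ler_pM2l (exprn_gt0 2 rho0)) [leRHS]mulrCA diffE.
rewrite (_ : rho ^+ 2 - P ^+ 2 = (rho - P) * (rho + P)); last by ring.
have rP : 0 <= rho * (rho - P) by rewrite mulr_ge0 ?subr_ge0// ltW.
have := ler_wpM2l rP key; lra.
Qed.

Lemma esqrt_le (R : realType) (x : \bar R) (c : R) :
  (x <= c%:E)%E -> (esqrt x <= (Num.sqrt c)%:E)%E.
Proof.
by case: x => [x| |] //=; rewrite !lee_fin => xc; rewrite ler_wsqrtr.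
Qed.

Section transport.
Context {R : realType} {s : nat}.
Local Notation N := s.+2.
Local Notation V := (N.-tuple R).

Definition sqcost (z : V * V) : R :=
  N%:R^-1 * \sum_(i < N) (tnth z.1 i - tnth z.2 i) ^+ 2.

Lemma measurable_sqcost : measurable_fun [set: V * V] sqcost.
Proof.
apply: measurable_funM => //; apply: measurable_sum => i.
apply: measurable_funX; apply: measurable_funB.
  by apply: (measurableT_comp (measurable_tnth i)); exact: measurable_fst.
by apply: (measurableT_comp (measurable_tnth i)); exact: measurable_snd.
Qed.

(** The difference of the two images is again an affine image of [x], and the cross term vanishes
    because the coordinates of [x] sum to 0. *)
Lemma sqcost_affine (m r m' r' : R) (x : V) : MCsurface 0 1 x ->
  sqcost (affine m r x, affine m' r' x) = (m - m') ^+ 2 + (r - r') ^+ 2.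
Proof.
move=> [x1 x2]; rewrite /sqcost/=.
have -> : \sum_(i < N) (tnth (affine m r x) i - tnth (affine m' r' x) i) ^+ 2 =
    \sum_(i < N) tnth (affine (m - m') (r - r') x) i ^+ 2.
  by apply: eq_bigr => i _; rewrite !tnth_affine; ring.
have N0 : N%:R != 0 :> R by rewrite pnatr_eq0.
by rewrite sum_sqr_affine x1 x2; move: (N%:R : R) N0 => n n0; field.
Qed.

Lemma measurable_affine_pair (m r m' r' : R) :
  measurable_fun [set: V] (fun x => (affine m r x, affine m' r' x)).
Proof. by apply: measurable_fun_pair; exact: measurable_affine. Qed.

Definition affine_pair (m r m' r' : R) : {mfun V >-> (V * V)%type} :=
  HB.pack_for {mfun V >-> (V * V)%type} (fun x : V => (affine m r x, affine m' r' x))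
    (isMeasurableFun.Build _ _ _ _ _ (measurable_affine_pair m r m' r')).

Lemma w2_mixture_le (mu1 mu2 : set V -> \bar R) (m r m' r' : R) :
  (forall A, mu1 A = (2^-1)%:E * uniform01 (affine m r @^-1` A) +
                     (2^-1)%:E * uniform01 (affine (- m) r @^-1` A))%E ->
  (forall A, mu2 A = (2^-1)%:E * uniform01 (affine m' r' @^-1` A) +
                     (2^-1)%:E * uniform01 (affine (- m') r' @^-1` A))%E ->
  (w2 mu1 mu2 <= (Num.sqrt ((m - m') ^+ 2 + (r - r') ^+ 2))%:E)%E.
Proof.
move=> mu1E mu2E; set c := _ + _; apply: esqrt_le.
pose gamma : probability (V * V)%type R :=
  mixture uniform01 (affine_pair m r m' r') (affine_pair (- m) r (- m') r').
apply: (@le_trans _ _ (\int[gamma]_z (sqcost z)%:E)%E).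
  apply: ereal_inf_lbound; exists gamma => //; split => A mA.
    rewrite mu1E; apply: etrans; first exact: mixtureE.
    have pre a b a' b' : affine_pair a b a' b' @^-1` (A `*` setT) = affine a b @^-1` A.
      by apply/seteqP; split => x //= [].
    by rewrite !pre.
  rewrite mu2E; apply: etrans; first exact: mixtureE.
  have pre a b a' b' : affine_pair a b a' b' @^-1` (setT `*` A) = affine a' b' @^-1` A.
    by apply/seteqP; split => x //= [].
  by rewrite !pre.
have cost0 z : 0 <= sqcost z.
  by rewrite mulr_ge0// sumr_ge0// => i _; exact: sqr_ge0.
have mcost : measurable_fun [set: V * V] (fun z => (sqcost z)%:E).
  by apply/measurable_EFinP; exact: measurable_sqcost.
apply: (@le_trans _ _ (\int[gamma]_z c%:E)%E); last first.
  rewrite integral_cst//= [X in (_ * X)%E](_ : _ = 1%E) ?mule1//.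
  exact: (@probability_setT _ _ _ gamma).
(* The cost equals [c] only at pairs coming from the surface, hence almost everywhere for [gamma];
   the exceptional set has a preimage that misses the surface. *)
apply: ae_ge0_le_integral => //.
- by move=> z _; rewrite lee_fin.
- by move=> z _; rewrite lee_fin addr_ge0 ?sqr_ge0.
exists [set z | c < sqcost z]; split.
- rewrite -[X in measurable X]setTI (_ : [set z | _] = sqcost @^-1` `]c, +oo[).
    by apply: measurable_sqcost => //; exact: measurable_itv.
  by apply/seteqP; split => z /=; rewrite in_itv/= andbT.
- have zero a a' : (a - a') ^+ 2 = (m - m') ^+ 2 ->
      uniform01 (affine_pair a r a' r' @^-1` [set z | c < sqcost z]) = 0%E.
    move=> aa'; apply: uniform01_disjoint => x Sx /=.
    by rewrite sqcost_affine// aa' ltxx.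
  apply: etrans; first exact: mixtureE.
  apply: (@etrans _ _ ((2^-1)%:E * 0 + (2^-1)%:E * 0)%E); last by rewrite mule0 adde0.
  by congr (_ * _ + _ * _)%E; apply: zero => //; ring.
- by move=> z /= h; rewrite ltNge; apply/negP => zc; apply: h => _; rewrite lee_fin.
Qed.

End transport.

(** * The two bounds for the microcanonical ensembles *)

Lemma muMC_epsE (R : realType) (s : nat) (J rho eps : R) (A : set (s.+2.-tuple R)) :
  let m := Num.sqrt (- (2 * eps) / J) in
  m ^+ 2 < rho ->
  muMC_eps J eps rho A =
    ((2^-1)%:E * uniform01 (affine m (Num.sqrt (rho - m ^+ 2)) @^-1` A) +
     (2^-1)%:E * uniform01 (affine (- m) (Num.sqrt (rho - m ^+ 2)) @^-1` A))%E.
Proof.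
move=> m mrho; rewrite /muMC_eps -/m.
have /(@muMC_m_affine _ _ (- m)) -> : (- m) ^+ 2 < rho by rewrite sqrrN.
rewrite (muMC_m_affine _ mrho) sqrrN; case: eqP => // eps0.
(* At zero energy both signs give the same measure, so the mixture formula also covers this case. *)
have -> : m = 0 by rewrite /m eps0 mulr0 oppr0 mul0r sqrtr0.
rewrite oppr0 (@muMC_m_affine _ _ 0 rho); last first.
  by move: mrho; apply: le_lt_trans; rewrite expr0n sqr_ge0.
rewrite -ge0_muleDl ?lee_fin// -EFinD (_ : 2^-1 + 2^-1 = 1) ?mul1e//.
by field.
Qed.

Theorem theorem4p11 (R : realType) (N : nat) (J rho eps eps' : R) :
  (2 <= N)%N -> 0 < J -> 0 < rho ->
  - (rho * J / 2) < eps <= 0 -> - (rho * J / 2) < eps' <= 0 ->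
  (eps != 0 ->
    (w2 (@muMC_eps R N J eps rho) (@muMC_eps R N J eps' rho) <=
     ((2 / J) * (Num.sqrt (- (2 * eps) / J) *
                 Num.sqrt (1 - (- (2 * eps) / (J * rho))))^-1
       * `|eps - eps'|)%:E)%E) /\
  (eps = 0 ->
    (w2 (@muMC_eps R N J 0 rho) (@muMC_eps R N J eps' rho) <=
     (2 / Num.sqrt J * Num.sqrt `|eps'|)%:E)%E).
Proof.
case: N => [|[|s]]// _ J0 rho0.
have msqr e : e <= 0 -> Num.sqrt (- (2 * e) / J) ^+ 2 = - (2 * e) / J.
  by move=> e0; rewrite sqr_sqrtr// divr_ge0 ?(ltW J0)//; lra.
have mrho e : - (rho * J / 2) < e <= 0 -> Num.sqrt (- (2 * e) / J) ^+ 2 < rho.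
  by move=> /andP[e1 e0]; rewrite msqr// ltr_pdivrMr//; lra.
move=> eps_itv eps'_itv.
have := @w2_mixture_le R s _ _ _ _ _ _ (fun A => muMC_epsE A (mrho _ eps_itv))
                      (fun A => muMC_epsE A (mrho _ eps'_itv)).
have [mE m'E] := (msqr _ (andP eps_itv).2, msqr _ (andP eps'_itv).2).
move: mE m'E (mrho _ eps_itv) (mrho _ eps'_itv).
have := sqrtr_ge0 (- (2 * eps') / J); have := sqrtr_ge0 (- (2 * eps) / J).
set m := Num.sqrt (- (2 * eps) / J); set m' := Num.sqrt (- (2 * eps') / J).
move=> m0 m'0 mE m'E mlt m'lt.
have r0 := sqrtr_ge0 (rho - m ^+ 2); have r'0 := sqrtr_ge0 (rho - m' ^+ 2).
have : Num.sqrt (rho - m ^+ 2) ^+ 2 = rho - m ^+ 2 by rewrite sqr_sqrtr// subr_ge0 ltW.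
have : Num.sqrt (rho - m' ^+ 2) ^+ 2 = rho - m' ^+ 2 by rewrite sqr_sqrtr// subr_ge0 ltW.
move: r0 r'0; set r := Num.sqrt _; set r' := Num.sqrt _ => r0 r'0 r'E rE.
move=> w2_bound; split=> eps0.
  apply: (le_trans w2_bound); rewrite lee_fin.
  have m2gt0 : 0 < m ^+ 2.
    rewrite mE divr_gt0//; have /andP[_] := eps_itv; rewrite le_eqVlt (negbTE eps0)/=.
    by lra.
  have vE : 1 - - (2 * eps) / (J * rho) = r ^+ 2 / rho.
    by rewrite rE mE; field; rewrite !gt_eqF.
  rewrite vE; set v := Num.sqrt (r ^+ 2 / rho).
  have r2gt0 : 0 < r ^+ 2 by rewrite rE subr_gt0.
  have v2 : v ^+ 2 = r ^+ 2 / rho by rewrite sqr_sqrtr// divr_ge0// ltW.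
  have B0 : 0 <= 2 / J * (m * v)^-1 * `|eps - eps'|.
    by rewrite !mulr_ge0 ?invr_ge0 ?mulr_ge0// ?sqrtr_ge0// ltW.
  (* Squares are compared. As [m ^+ 2] is affine in the energy, the squared bound becomes the
     right-hand side of [chord_le] divided by [m ^+ 2 * r ^+ 2]. *)
  rewrite -(ger0_norm B0) -sqrtr_sqr ler_wsqrtr//.
  rewrite !exprMn real_normK ?num_real// !exprVn exprMn v2.
  have -> : 2 ^+ 2 * (J ^+ 2)^-1 * (m ^+ 2 * (r ^+ 2 / rho))^-1 * (eps - eps') ^+ 2 =
      rho * (m ^+ 2 - m' ^+ 2) ^+ 2 / (m ^+ 2 * r ^+ 2).
    have -> : m ^+ 2 - m' ^+ 2 = - (2 / J) * (eps - eps') by rewrite mE m'E; field; rewrite gt_eqF.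
    by move: (m ^+ 2) (r ^+ 2) m2gt0 r2gt0 => a b a0 b0; field; rewrite !gt_eqF.
  rewrite ler_pdivlMr; last exact: (mulr_gt0 m2gt0 r2gt0).
  by apply: chord_le => //; [rewrite rE|rewrite r'E]; rewrite addrC subrK.
have mz : m = 0 by rewrite /m eps0 mulr0 oppr0 mul0r sqrtr0.
have <- : @muMC_eps R s.+2 J eps rho = muMC_eps J 0 rho by rewrite eps0.
apply: (le_trans w2_bound); rewrite lee_fin.
have /andP[_ eps'0] := eps'_itv.
have B0 : 0 <= 2 / Num.sqrt J * Num.sqrt `|eps'|.
  by rewrite !mulr_ge0 ?invr_ge0 ?sqrtr_ge0.
rewrite -(ger0_norm B0) -sqrtr_sqr ler_wsqrtr//.
rewrite !exprMn exprVn !sqr_sqrtr ?(ltW J0)// ler0_norm//.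
have -> : 2 ^+ 2 / J * - eps' = 2 * m' ^+ 2 by rewrite m'E; field; rewrite gt_eqF.
(* With [m = 0], this gives [(r - r') ^+ 2 <= r ^+ 2 - r' ^+ 2 = m' ^+ 2], so the cost is at most
   [2 * m' ^+ 2]. *)
have r'r : r' <= r.
  by rewrite ler_wsqrtr// lerD2l lerN2 mz expr0n sqr_ge0.
move: rE; rewrite mz; nra.
Qed.
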